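(* Let $A = C + S \in \mathbb{C}^{n\times n}$ be a non-Hermitian Toeplitz matrix, where $C$ and $S$ are the circulant and skew-circulant parts of $A$, and suppose that $C$ and $S$ are both positive definite. Let $\sigma>0$, let $\bm{b}\in\mathbb{C}^n$, and suppose that $\eta = \|A^{-1}\|_2 < 1$. Then the absolute value equation $A\bm{x} - |\bm{x}| = \bm{b}$ has a unique solution $\bm{x}^{*}\in\mathbb{C}^n$, and for any initial guess $\bm{x}^{(0)}\in\mathbb{C}^n$ and any sequence of positive integers $\{l_k\}_{k=0}^{\infty}$, the iteration sequence $\{\bm{x}^{(k)}\}_{k=0}^{\infty}$ produced by the Picard-CSCS iteration method converges to $\bm{x}^{*}$ provided that $l = \liminf_{k\to\infty} l_k \geq N$, where $N$ is a natural number satisfying $$\big\|(\mathcal{M}(\sigma))^s\big\|_2 < \frac{1-\eta}{1+\eta}\qquad \text{for all } s\geq N,$$ with $\mathcal{M}(\sigma) = (\sigma I + S)^{-1}(\sigma I - C)(\sigma I + C)^{-1}(\sigma I - S)$.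
   Context: For $\bm{x}=(x_1,\dots,x_n)^T\in\mathbb{C}^n$, $|\bm{x}|=(|x_1|,\dots,|x_n|)^T$ is the componentwise absolute value (modulus). $I$ is the identity matrix of order $n$, and $\|\cdot\|_2$ is the Euclidean vector norm and the induced matrix norm. Circulant and skew-circulant splitting (CSCS): let $A$ be a Toeplitz matrix with entries $A_{jk}=a_{j-k}$, $0\le j,k\le n-1$. Its circulant part $C$ and skew-circulant part $S$ are the matrices with entries, for $0\le j,k\le n-1$: - $C_{jj}=S_{jj}=\tfrac12 a_0$; - if $j>k$: $C_{jk}=\tfrac12(a_{j-k}+a_{j-k-n})$ and $S_{jk}=\tfrac12(a_{j-k}-a_{j-k-n})$; - if $j<k$: $C_{jk}=\tfrac12(a_{j-k}+a_{j-k+n})$ and $S_{jk}=\tfrac12(a_{j-k}-a_{j-k+n})$. Then $A=C+S$. Here $C$ (or $S$) is called positive definite if the real parts of all its eigenvalues are positive. Picard-CSCS iteration method: given $\sigma>0$, an initial guess $\bm{x}^{(0)}\in\mathbb{C}^n$ and a sequence $\{l_k\}_{k=0}^\infty$ of positive integers, for $k=0,1,2,\dots$ set $\bm{x}^{(k,0)}=\bm{x}^{(k)}$; for $\ell=0,1,\dots,l_k-1$ define $\bm{x}^{(k,\ell+\frac12)}$ and $\bm{x}^{(k,\ell+1)}$ by $$(\sigma I + C)\bm{x}^{(k,\ell+\frac12)} = (\sigma I - S)\bm{x}^{(k,\ell)} + |\bm{x}^{(k)}| + \bm{b},$$ $$(\sigma I + S)\bm{x}^{(k,\ell+1)} = (\sigma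 I - C)\bm{x}^{(k,\ell+\frac12)} + |\bm{x}^{(k)}| + \bm{b};$$ and set $\bm{x}^{(k+1)}=\bm{x}^{(k,l_k)}$. *)

(* Defs.v *)
From HB Require Import structures.
From mathcomp Require Import all_boot all_order all_algebra sesquilinear.
From mathcomp Require Import complex.
From mathcomp Require Import all_classical all_reals all_analysis.

Set Implicit Arguments.
Unset Strict Implicit.
Unset Printing Implicit Defensive.

Import Order.TTheory GRing.Theory Num.Theory.
Import numFieldNormedType.Exports.

Local Open Scope classical_set_scope.
Local Open Scope ring_scope.

(* C^n is 'cV[R[i]]_n, with R : realType.  The norms below take their values
   in R, through the real-valued modulus normc; the norm `|z| on R[i] is the
   modulus of z viewed as an element of R[i]. *)

Definition cabs (R : realType) (n : nat) (x : 'cV[R[i]]_n) : 'cV[R[i]]_n :=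
  \col_i `|x i 0|.

Definition norm2 (R : realType) (n : nat) (x : 'cV[R[i]]_n) : R :=
  Num.sqrt (\sum_(i < n) (ComplexField.Normc.normc (x i 0)) ^+ 2).

(* The supremum is taken over the closed unit ball; the set is nonempty and
   bounded, so that sup does not take its default value. *)
Definition opnorm2 (R : realType) (n : nat) (B : 'M[R[i]]_n) : R :=
  sup [set norm2 (B *m x) | x in [set x : 'cV[R[i]]_n | norm2 x <= 1]].

(* Only the values a d with -n < d < n are used. *)
Definition toeplitz (R : realType) (n : nat) (a : int -> R[i]) : 'M[R[i]]_n :=
  \matrix_(j < n, k < n) a (j%:Z - k%:Z).

Definition circ_part (R : realType) (n : nat) (a : int -> R[i]) :
    'M[R[i]]_n :=
  \matrix_(j < n, k < n)
    if (k < j)%N then 2^-1 * (a (j%:Z - k%:Z) + a (j%:Z - k%:Z - n%:Z))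
    else if (j < k)%N then 2^-1 * (a (j%:Z - k%:Z) + a (j%:Z - k%:Z + n%:Z))
    else 2^-1 * a 0.

Definition skew_circ_part (R : realType) (n : nat) (a : int -> R[i]) :
    'M[R[i]]_n :=
  \matrix_(j < n, k < n)
    if (k < j)%N then 2^-1 * (a (j%:Z - k%:Z) - a (j%:Z - k%:Z - n%:Z))
    else if (j < k)%N then 2^-1 * (a (j%:Z - k%:Z) - a (j%:Z - k%:Z + n%:Z))
    else 2^-1 * a 0.

Definition posdef (R : realType) (n : nat) (B : 'M[R[i]]_n) : Prop :=
  forall z : R[i], eigenvalue B z -> 0 < complex.Re z.

Definition ave_solution (R : realType) (n : nat) (A : 'M[R[i]]_n)
    (b x : 'cV[R[i]]_n) : Prop :=
  A *m x - cabs x = b.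

(* One outer step, from x to x', with m inner sweeps: y l is the l-th inner
   iterate and h l is the half-step iterate between y l and y l.+1. *)
Definition picard_cscs_step (R : realType) (n : nat) (C S : 'M[R[i]]_n)
    (sigma : R) (b : 'cV[R[i]]_n) (m : nat) (x x' : 'cV[R[i]]_n) : Prop :=
  exists y h : nat -> 'cV[R[i]]_n,
    [/\ y 0%N = x,
        forall l : nat, (l < m)%N ->
          ((sigma%:C)%C%:M + C) *m h l
            = ((sigma%:C)%C%:M - S) *m y l + cabs x + b /\
          ((sigma%:C)%C%:M + S) *m y l.+1
            = ((sigma%:C)%C%:M - C) *m h l + cabs x + b
      & x' = y m].

Definition picard_cscs (R : realType) (n : nat) (C S : 'M[R[i]]_n)
    (sigma : R) (b x0 : 'cV[R[i]]_n) (l : nat -> nat)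
    (x : nat -> 'cV[R[i]]_n) : Prop :=
  x 0%N = x0 /\
  forall k : nat, picard_cscs_step C S sigma b (l k) (x k) (x k.+1).

Definition iter_mx (R : realType) (n : nat) (C S : 'M[R[i]]_n) (sigma : R) :
    'M[R[i]]_n :=
  invmx ((sigma%:C)%C%:M + S) *m ((sigma%:C)%C%:M - C)
    *m invmx ((sigma%:C)%C%:M + C) *m ((sigma%:C)%C%:M - S).

(* Main.v *)
Require Import Defs.
From HB Require Import structures.
From mathcomp Require Import all_boot all_order all_algebra sesquilinear.
From mathcomp Require Import complex.
From mathcomp Require Import all_classical all_reals all_analysis.
From mathcomp Require Import spectral zify lra.

Set Implicit Arguments.
Unset Strict Implicit.
Unset Printing Implicit Defensive.

Import Order.TTheory GRing.Theory Num.Theory.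
Import numFieldNormedType.Exports.

Local Open Scope classical_set_scope.
Local Open Scope ring_scope.

Import ComplexField.Normc.

(** Circulant and skew-circulant matrices are normal.  A normal matrix whose
    eigenvalues have positive real parts has its numerical range in the open
    right half-plane ([posdef_normal_form_gt0]), and this property, unlike the one
    on eigenvalues, passes to the sum A = C + S: so A is invertible
    ([posdef_normalD_unit]).  Likewise sigma + C and sigma + S are invertible,
    since -sigma is an eigenvalue of neither C nor S.

    The absolute value equation then reads x = A^-1 (|x| + b).  As the modulus is
    1-Lipschitz, the right-hand side is a contraction of constant eta < 1, and it
    has a unique fixed point xs ([ave_unique_solution]).

    In one outer step from x, the inner sweeps solve the linear system
    A z = |x| + b approximately: each sweep multiplies the distance vector to z by
    the iteration matrix M ([cscs_inner_error]).  With theta the norm of the power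
    of M that is applied, the new iterate x' satisfies
    |x' - xs| <= (theta (1 + eta) + eta) |x - xs| ([cscs_outer_contraction]), and
    the factor is below 1 as soon as theta < (1 - eta) / (1 + eta).  For
    convergence the factors have to stay away from 1 while the number of sweeps
    varies; this holds because the powers of M of large exponent are bounded by
    finitely many of them ([opnorm2_powers_uniform]). *)

(** * The modulus on R[i] *)

Section Modulus.
Variable R : realType.
Implicit Types z w : R[i].

Lemma normc_ge0 z : 0 <= normc z.
Proof. by case: z => u v; rewrite sqrtr_ge0. Qed.

Lemma normc_gt0 z : (0 < normc z) = (z != 0).
Proof.
rewrite lt_def normc_ge0 andbT; congr (~~ _); apply/eqP/eqP => [/eq0_normc //|->].
exact: normc0.
Qed.

Lemma sqr_normcE z : ((normc z ^+ 2)%:C)%C = z * (z^*)%R.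
Proof. by rewrite -normCK rmorphXn. Qed.

Lemma normc_le_ReIm w : normc w <= `|complex.Re w| + `|complex.Im w|.
Proof.
case: w => s t /=; rewrite -[X in _ <= X]ger0_norm ?addr_ge0 // -sqrtr_sqr.
rewrite ler_wsqrtr // sqrrD !real_normK ?num_real // -addrA lerD2l lerDr.
by rewrite mulrn_wge0 ?mulr_ge0.
Qed.

Lemma Re_le_normc w : `|complex.Re w| <= normc w.
Proof.
by case: w => s t /=; rewrite -sqrtr_sqr ler_wsqrtr // lerDl sqr_ge0.
Qed.

Lemma Im_le_normc w : `|complex.Im w| <= normc w.
Proof.
by case: w => s t /=; rewrite -sqrtr_sqr ler_wsqrtr // lerDr sqr_ge0.
Qed.

End Modulus.

(** * Euclidean norm and operator norm *)

Section EuclideanNorm.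
Variables (R : realType) (n : nat).
Implicit Types (x y : 'cV[R[i]]_n) (B D : 'M[R[i]]_n).

(** The triangle inequality is available for Hermitian forms over a closed field,
    with values in that field; this identity carries it over to the real-valued
    [norm2]. *)
Lemma norm2_dotmx x : ((norm2 x)%:C)%C = sqrtC (dotmx x^T x^T).
Proof.
apply/eqP; rewrite -(@eqrXn2 _ 2)//; last 2 first.
- by rewrite lecR sqrtr_ge0.
- by rewrite sqrtC_ge0 dnorm_ge0.
rewrite sqrtCK -rmorphXn /= sqr_sqrtr; last first.
  by apply: sumr_ge0 => i _; rewrite sqr_ge0.
rewrite dotmxE mxE rmorph_sum /=; apply/eqP; apply: eq_bigr => i _.
by rewrite sqr_normcE !mxE.
Qed.

Lemma norm2_ge0 x : 0 <= norm2 x.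
Proof. exact: sqrtr_ge0. Qed.

Lemma norm2D x y : norm2 (x + y) <= norm2 x + norm2 y.
Proof.
rewrite -lecR rmorphD /= !norm2_dotmx linearD /=.
by rewrite (triangle_lerif (@dotmx R[i] n)).
Qed.

Lemma norm2N x : norm2 (- x) = norm2 x.
Proof. by congr Num.sqrt; apply: eq_bigr => i _; rewrite mxE normcN. Qed.

Lemma norm2B x y : norm2 (x - y) <= norm2 x + norm2 y.
Proof. by rewrite -[norm2 y]norm2N norm2D. Qed.

Lemma norm2Z (c : R[i]) x : norm2 (c *: x) = normc c * norm2 x.
Proof.
rewrite /norm2 -[X in X * _]ger0_norm ?normc_ge0 // -sqrtr_sqr -sqrtrM ?sqr_ge0 //.
congr Num.sqrt; rewrite mulr_sumr; apply: eq_bigr => i _.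
by rewrite mxE normcM exprMn.
Qed.

Lemma norm2_0 : norm2 (0 : 'cV[R[i]]_n) = 0.
Proof. by rewrite -(scale0r 0) norm2Z normc0 mul0r. Qed.

Lemma normc_le_norm2 x i : normc (x i 0) <= norm2 x.
Proof.
rewrite -[X in X <= _]ger0_norm ?normc_ge0 // -sqrtr_sqr ler_wsqrtr //.
by rewrite (bigD1 i) //= lerDl sumr_ge0 // => j _; rewrite sqr_ge0.
Qed.

Lemma norm2_le_sum x : norm2 x <= \sum_i normc (x i 0).
Proof.
have s0 : 0 <= \sum_i normc (x i 0) by apply: sumr_ge0 => i _; apply: normc_ge0.
rewrite -[X in _ <= X]ger0_norm // -sqrtr_sqr ler_wsqrtr // expr2 mulr_suml.
apply: ler_sum => i _; rewrite expr2 ler_wpM2l ?normc_ge0 //.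
by rewrite (bigD1 i) //= lerDl sumr_ge0 // => j _; rewrite normc_ge0.
Qed.

Lemma norm2_eq0 x : norm2 x = 0 -> x = 0.
Proof.
move=> x0; apply/colP => i; rewrite [RHS]mxE; apply: eq0_normc.
by apply/le_anti; rewrite normc_ge0 andbT -x0 normc_le_norm2.
Qed.

(** The reverse triangle inequality in each coordinate makes the modulus
    1-Lipschitz; this is all that the analysis uses about [cabs]. *)
Lemma norm2_cabsB x y : norm2 (cabs x - cabs y) <= norm2 (x - y).
Proof.
rewrite ler_wsqrtr //; apply: ler_sum => i _; rewrite ler_sqr ?nnegrE ?normc_ge0 //.
by rewrite !mxE -lecR; exact: (@ler_dist_dist R[i] R[i]).
Qed.

(** The sum of the moduli of all entries is a crude bound, enough for the supremum
    to be a genuine one. *)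
Lemma opnorm2_has_sup B :
  has_sup [set norm2 (B *m x) | x in [set x : 'cV[R[i]]_n | norm2 x <= 1]].
Proof.
split; first by exists (norm2 (B *m 0)), 0; rewrite //= norm2_0.
exists (\sum_i \sum_j normc (B i j)) => _ [x /= x1 <-].
apply: le_trans (norm2_le_sum _) _; apply: ler_sum => i _; rewrite mxE.
apply: (@le_trans _ _ (\sum_j normc (B i j * x j 0))).
  elim/big_ind2: _ => [|u s v t us vt|//]; first by rewrite normc0.
  by apply: le_trans (le_normcD _ _) (lerD us vt).
apply: ler_sum => j _; rewrite normcM ler_piMr ?normc_ge0 //.
exact: le_trans (normc_le_norm2 _ _) x1.
Qed.

Lemma norm2_mulmx_unit_ball B x : norm2 x <= 1 -> norm2 (B *m x) <= opnorm2 B.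
Proof. by move=> x1; apply: (sup_ubound (opnorm2_has_sup B).2); exists x. Qed.

Lemma opnorm2_ge0 B : 0 <= opnorm2 B.
Proof.
by apply: le_trans (norm2_mulmx_unit_ball B (x := 0) _); rewrite ?norm2_ge0 ?norm2_0.
Qed.

Lemma norm2_mulmx B x : norm2 (B *m x) <= opnorm2 B * norm2 x.
Proof.
have [/norm2_eq0 ->|x0] := eqVneq (norm2 x) 0; first by rewrite mulmx0 norm2_0 mulr0.
have xgt0 : 0 < norm2 x by rewrite lt_def x0 norm2_ge0.
have normV : normc ((norm2 x)^-1%:C)%C = (norm2 x)^-1.
  by rewrite /= expr0n addr0 sqrtr_sqr ger0_norm // invr_ge0 ltW.
have := norm2_mulmx_unit_ball B (x := ((norm2 x)^-1%:C)%C *: x).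
rewrite -scalemxAr !norm2Z normV mulVf // => /(_ (lexx _)).
by rewrite ler_pdivrMl // mulrC.
Qed.

Lemma opnorm2_le B c :
  (forall x, norm2 x <= 1 -> norm2 (B *m x) <= c) -> opnorm2 B <= c.
Proof.
move=> Bc; apply: sup_le_ub (opnorm2_has_sup B).1 _.
by move=> _ [x /= x1 <-]; apply: Bc.
Qed.

Lemma opnorm2M B D : opnorm2 (B *m D) <= opnorm2 B * opnorm2 D.
Proof.
apply: opnorm2_le => x x1; rewrite -mulmxA.
apply: le_trans (norm2_mulmx _ _) (ler_wpM2l (opnorm2_ge0 _) _).
exact: norm2_mulmx_unit_ball.
Qed.

End EuclideanNorm.

(** * Normality of the two parts and invertibility *)

Local Open Scope sesquilinear_scope.

(** Both parts of the splitting are instances, with [w = 1] and [w = -1]: the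
    entry at (j, k) depends on j - k only, and is multiplied by [w] when j - k
    grows by [n].  Differences are written as sums, to stay within the natural
    numbers. *)
Definition twisted_circulant (F : pzRingType) (n : nat) (w : F) (B : 'M[F]_n) : Prop :=
  (forall j k j' k' : 'I_n, (j + k' = j' + k)%N -> B j k = B j' k') /\
  (forall j k j' k' : 'I_n, (j + k' + n = j' + k)%N -> B j' k' = w * B j k).

(** The (j, k) entry of B B^H is the sum over m of B j m conj(B k m), that of
    B^H B the sum of conj(B m j) B m k.  The involution m |-> m' = j + k - m mod n
    exchanges the summands: the differences j - m and k - m become m' - k and
    m' - j, up to the same multiple of n, so that the factor is w conj(w) = 1. *)
Lemma twisted_circulant_normal (K : numClosedFieldType) (n : nat) (w : K) (B : 'M[K]_n) :
  w * w^* = 1 -> twisted_circulant w B -> B \is normalmx.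
Proof.
move=> w1 [Beq Bwrap]; apply/normalmxP/matrixP => j k; rewrite !mxE.
have n0 : (0 < n)%N by exact: leq_ltn_trans (ltn_ord j).
(* s m is j + k - m modulo n; the shift by n keeps the subtraction from being
   truncated. *)
pose s (m : 'I_n) := Ordinal (ltn_pmod (j + k + n - m) n0).
have s_eq (m : 'I_n) : [\/ (s m + m = j + k + n)%N, (s m + m = j + k)%N
    | (s m + m + n = j + k)%N].
  have := ltn_ord m; have := ltn_ord j; have := ltn_ord k.
  have := divn_eq (j + k + n - m) n; have := ltn_pmod (j + k + n - m) n0.
  rewrite -[((j + k + n - m) %% n)%N]/(nat_of_ord (s m)).
  set q := (_ %/ _)%N => ? E ? ? ?.
  have : (q < 3)%N by rewrite ltnNge; apply/negP => /(leq_mul (leqnn n)); lia.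
  by case: q E => [|[|[|//]]] E _; [constructor 1|constructor 2|constructor 3]; lia.
have sK : involutive s.
  move=> m; apply/val_inj => /=.
  have := s_eq m; have := s_eq (s m); have := ltn_ord m; have := ltn_ord (s (s m)).
  by rewrite /= => ? ? [] ? [] ?; lia.
rewrite [RHS](reindex_inj (inv_inj sK)); apply: eq_bigr => m _; rewrite !mxE.
case: (s_eq m) => E.
- rewrite (Bwrap j m (s m) k) 1?(Bwrap k m (s m) j); try lia.
  by rewrite rmorphM mulrACA [w^* * w]mulrC w1 mul1r mulrC.
- by rewrite (Beq j m (s m) k) 1?(Beq k m (s m) j) 1?mulrC; try lia.
- rewrite (Bwrap (s m) k j m) 1?(Bwrap (s m) j k m); try lia.
  by rewrite rmorphM mulrACA w1 mul1r mulrC.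
Qed.

Section Splitting.
Variables (R : realType) (n : nat).
Implicit Types (a : int -> R[i]) (B C S : 'M[R[i]]_n) (v : 'rV[R[i]]_n).

Lemma circ_part_circulant a : twisted_circulant 1 (circ_part n a).
Proof.
split=> j k j' k' E; rewrite !mxE.
  have -> : j%:Z - k%:Z = j'%:Z - k'%:Z by lia.
  by case: (ltngtP k j) (ltngtP k' j') => [?|?|?] [?|?|?] //; lia.
have jk : (j < k)%N by have := ltn_ord j'; lia.
have kj' : (k' < j')%N by have := ltn_ord k; lia.
have -> : j'%:Z - k'%:Z = j%:Z - k%:Z + n%:Z by lia.
by rewrite kj' ltnNge (ltnW jk) /= jk addrK mul1r addrC.
Qed.

Lemma skew_circ_part_circulant a : twisted_circulant (-1) (skew_circ_part n a).
Proof.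
split=> j k j' k' E; rewrite !mxE.
  have -> : j%:Z - k%:Z = j'%:Z - k'%:Z by lia.
  by case: (ltngtP k j) (ltngtP k' j') => [?|?|?] [?|?|?] //; lia.
have jk : (j < k)%N by have := ltn_ord j'; lia.
have kj' : (k' < j')%N by have := ltn_ord k; lia.
have -> : j'%:Z - k'%:Z = j%:Z - k%:Z + n%:Z by lia.
by rewrite kj' ltnNge (ltnW jk) /= jk addrK mulN1r -mulrN opprB.
Qed.

Lemma circ_part_normal a : circ_part n a \is normalmx.
Proof.
by apply: twisted_circulant_normal (circ_part_circulant a); rewrite rmorph1 mulr1.
Qed.

Lemma skew_circ_part_normal a : skew_circ_part n a \is normalmx.
Proof.
apply: twisted_circulant_normal (skew_circ_part_circulant a).
by rewrite rmorphN rmorph1 mulrNN mulr1.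
Qed.

Lemma toeplitz_splitting a : toeplitz n a = circ_part n a + skew_circ_part n a.
Proof.
apply/matrixP => j k; rewrite !mxE.
have half (u v : R[i]) : 2^-1 * (u + v) + 2^-1 * (u - v) = u.
  by rewrite -mulrDr addrACA subrr addr0 -mulr2n -(mulr_natl u) mulKf // pnatr_eq0.
case: ltngtP => [_|_|jk]; rewrite ?half //.
by rewrite jk subrr -[LHS](half _ 0) subr0 addr0.
Qed.

(** A normal matrix is unitarily diagonalizable, so v B v^H is a combination of the
    eigenvalues with nonnegative weights |u_i|^2, not all zero.  Without
    normality, eigenvalues in the right half-plane would not bound the numerical
    range. *)
Lemma posdef_normal_form_gt0 B v :
  B \is normalmx -> posdef B -> v != 0 -> 0 < complex.Re (dotmx (v *m B) v).
Proof.
move=> /orthomx_spectralP; set P := spectralmx B; set d := spectral_diag B.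
move=> defB B_pos v0.
have Pu : P \is unitarymx := spectral_unitarymx B.
have Punit := unitarymx_unit Pu.
(* The rows of P are left eigenvectors. *)
have d_eig i : eigenvalue B (d 0 i).
  apply/eigenvalueP; exists (row i P); last first.
    apply: contraTneq Punit => rP0; rewrite -row_free_unit.
    by apply/row_freePn; exists i; rewrite rP0 sub0mx.
  rewrite [in LHS]defB -row_mul !mulmxA mulmxV // mul1mx row_mul row_diag_mx.
  by rewrite -scalemxAl -rowE.
pose u := v *m invmx P.
have u0 : u != 0 by apply: contraNneq v0 => u0; rewrite -(mulmxKV Punit v) -/u u0 mul0mx.
have -> : dotmx (v *m B) v = \sum_i d 0 i * ((normc (u 0 i)) ^+ 2)%:C%C.
  rewrite dotmxE {1}defB !mulmxA -/u -(mulmxA _ P).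
  have -> : P *m v ^t* = u ^t*.
    by rewrite /u invmx_unitary // trmx_mul map_mxM /= trmxCK.
  rewrite mxE; apply: eq_bigr => i _.
  by rewrite mul_mx_diag !mxE sqr_normcE mulrCA mulrA.
rewrite (raddf_sum (@complex.Re R)) /=.
have ReM i : complex.Re (d 0 i * ((normc (u 0 i)) ^+ 2)%:C%C) =
    complex.Re (d 0 i) * normc (u 0 i) ^+ 2.
  by case: (d 0 i) => p q /=; rewrite mulr0 subr0.
under eq_bigr do rewrite ReM.
have /rV0Pn[i ui] := u0.
rewrite (bigD1 i) //= ltr_wpDr ?mulr_gt0 ?normc_gt0 ?B_pos //.
by apply: sumr_ge0 => k _; rewrite mulr_ge0 ?sqr_ge0 // ltW // B_pos.
Qed.

(** Eigenvalues of a sum are not controlled by those of the summands, but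
    numerical ranges are: a null vector v of C + S would give
    0 = Re (v C v^H) + Re (v S v^H) > 0. *)
Lemma posdef_normalD_unit C S : C \is normalmx -> S \is normalmx ->
  posdef C -> posdef S -> C + S \in unitmx.
Proof.
move=> Cn Sn Cp Sp; rewrite -row_free_unit -kermx_eq0; apply/eqP/row_matrixP => i.
rewrite row0; apply/eqP/negPn/negP => v0.
have := addr_gt0 (posdef_normal_form_gt0 Cn Cp v0) (posdef_normal_form_gt0 Sn Sp v0).
rewrite -raddfD -linearDl /= -mulmxDr -row_mul mulmx_ker row0.
by rewrite linear0l ltxx.
Qed.

Lemma posdef_shift_unit B (sigma : R) :
  posdef B -> 0 < sigma -> (sigma%:C)%C%:M + B \in unitmx.
Proof.
move=> Bp s0; rewrite -row_free_unit -kermx_eq0; apply/negP => /negP ker0.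
have : eigenvalue B (- (sigma%:C)%C).
  by rewrite /eigenvalue /eigenspace raddfN opprK addrC.
by move/Bp => /=; rewrite oppr_gt0 ltNge ltW.
Qed.

End Splitting.

Local Close Scope sesquilinear_scope.

(** * Limits of real sequences *)

Section Limits.
Variable (R : realType).

Lemma geometric_increments_cvg (u : R^nat) (c q : R) : 0 <= c -> 0 <= q -> q < 1 ->
  (forall k, `|u k.+1 - u k| <= c * q ^+ k) -> cvgn u.
Proof.
move=> c0 q0 q1 uq.
have : cvgn (series (telescope u)).
  apply: normed_cvg; apply: (@series_le_cvg _ _ (geometric c q)) => //.
  - by move=> k; exact: normr_ge0.
  - by move=> k; rewrite /= mulr_ge0 ?exprn_ge0.
  - by apply: is_cvg_geometric_series; rewrite ger0_norm.
move=> tu; rewrite (_ : u = (fun k => u 0%N + series (telescope u) k)).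
  by apply: is_cvgD => //; exact: is_cvg_cst.
by apply/funext => k; rewrite -eq_sum_telescope.
Qed.

Lemma eventually_contracting_cvg0 (e : R^nat) (q : R) (K : nat) :
  (forall k, 0 <= e k) -> 0 <= q -> q < 1 ->
  (forall k, (K <= k)%N -> e k.+1 <= q * e k) -> e k @[k --> \oo] --> (0 : R).
Proof.
move=> e0 q0 q1 eq; rewrite -(cvg_shiftn K).
have bound k : e (k + K)%N <= geometric (e K) q k.
  elim: k => [|k IH] /=; first by rewrite expr0 mulr1.
  rewrite addSn exprS mulrCA.
  by apply: le_trans (eq _ (leq_addl _ _)) (ler_wpM2l q0 IH).
apply: (@squeeze_cvgr _ \oo _ _ (fun _ => 0) (geometric (e K) q)).
- by apply: nearW => k; rewrite e0 bound.
- exact: cvg_cst.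
- by apply: cvg_geometric; rewrite ger0_norm.
Qed.

(** For integer sequences a lower limit at least N is reached from some rank on,
    as N - 1 lies strictly below it. *)
Lemma limn_einf_nat_ge (l : nat -> nat) (N : nat) :
  ((N%:R : R)%:E <= limn_einf (fun k : nat => ((l k)%:R : R)%:E))%E ->
  exists K, forall k, (K <= k)%N -> (N <= l k)%N.
Proof.
case: N => [_|N]; first by exists 0%N.
rewrite limn_einf_lim (cvg_lim _ (@cvg_einfs_sup R _)) // => lN.
have : ((N%:R : R)%:E < ereal_sup (range (einfs (fun k => ((l k)%:R : R)%:E))))%E.
  by apply: lt_le_trans lN; rewrite lte_fin ltr_nat.
case/ereal_sup_gt => _ [K _ <-] lK; exists K => k Kk.
rewrite -(ltr_nat R) -lte_fin; apply: lt_le_trans lK _.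
by apply: ereal_inf_lbound; exists k.
Qed.

End Limits.

(** * Completeness and contractions in C^n *)

Section Completeness.
Variables (R : realType) (n : nat).
Implicit Types y z : 'cV[R[i]]_n.

(** Completeness of C^n in [norm2], obtained from that of the real line applied to
    the real and imaginary parts of the coordinates. *)
Lemma norm2_geometric_increments_cvg (x : nat -> 'cV[R[i]]_n) (c q : R) :
  0 <= c -> 0 <= q -> q < 1 ->
  (forall k, norm2 (x k.+1 - x k) <= c * q ^+ k) ->
  exists xs, norm2 (x k - xs) @[k --> \oo] --> (0 : R).
Proof.
move=> c0 q0 q1 xq.
have incr k i : normc (x k.+1 i 0 - x k i 0) <= c * q ^+ k.
  by apply: le_trans (xq k); have := normc_le_norm2 (x k.+1 - x k) i; rewrite !mxE.
have reC i : cvgn (fun k => complex.Re (x k i 0)).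
  apply: (@geometric_increments_cvg _ _ c q) => // k.
  by apply: le_trans (incr k i); rewrite -raddfB Re_le_normc.
have imC i : cvgn (fun k => complex.Im (x k i 0)).
  apply: (@geometric_increments_cvg _ _ c q) => // k.
  by apply: le_trans (incr k i); rewrite -raddfB Im_le_normc.
pose re i := limn (fun k => complex.Re (x k i 0)).
pose im i := limn (fun k => complex.Im (x k i 0)).
(* The limit is taken coordinate by coordinate; the error is dominated by err,
   a finite sum of null sequences. *)
exists (\col_i (re i +i* im i)%C).
pose err k := \sum_i (`|complex.Re (x k i 0) - re i| + `|complex.Im (x k i 0) - im i|).
apply: (@squeeze_cvgr _ \oo _ _ (fun _ => 0) err).
- apply: nearW => k; rewrite norm2_ge0 /=; apply: le_trans (norm2_le_sum _) _.
  apply: ler_sum => i _; rewrite !mxE; apply: le_trans (normc_le_ReIm _) _.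
  by rewrite !raddfB.
- exact: cvg_cst.
- rewrite (_ : 0 = \sum_(i < n) (`|re i - re i| + `|im i - im i|)); last first.
    by rewrite big1 // => i _; rewrite !subrr normr0 addr0.
  apply: cvg_big => [|i _]; first exact: add_continuous.
  by apply: cvgD; apply: cvg_norm; apply: cvgB (cvg_cst _);
     [exact: reC | exact: imC].
Qed.

Lemma norm2_cvg_unique (x : nat -> 'cV[R[i]]_n) y z :
  norm2 (x k - y) @[k --> \oo] --> (0 : R) ->
  norm2 (x k - z) @[k --> \oo] --> (0 : R) -> y = z.
Proof.
move=> xy xz; apply/eqP; rewrite -subr_eq0; apply/eqP/norm2_eq0/le_anti.
rewrite norm2_ge0 andbT; have /(_ _)/cvgr_to_ge := cvgD xz xy; rewrite addr0 => lim0.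
apply: lim0; apply: nearW => k /=.
have -> : y - z = (x k - z) - (x k - y) by rewrite opprB [RHS]addrC addrA subrK.
exact: norm2B.
Qed.

(** Banach's theorem for [norm2], which is not the norm carried by the canonical
    normed space of matrices. *)
Lemma norm2_contraction_fixpoint (f : 'cV[R[i]]_n -> 'cV[R[i]]_n) (q : R) :
  0 <= q -> q < 1 -> (forall x y, norm2 (f x - f y) <= q * norm2 (x - y)) ->
  exists2 xs, f xs = xs & forall y, f y = y -> y = xs.
Proof.
move=> q0 q1 fq; pose x k := iter k f 0.
have incr k : norm2 (x k.+1 - x k) <= norm2 (x 1%N - x 0%N) * q ^+ k.
  elim: k => [|k IH]; first by rewrite expr0 mulr1.
  by rewrite exprS mulrCA; apply: le_trans (fq _ _) (ler_wpM2l q0 IH).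
have [xs xsP] := norm2_geometric_increments_cvg (norm2_ge0 _) q0 q1 incr.
have fxs : f xs = xs.
  apply: (@norm2_cvg_unique (fun k => x k.+1)); last first.
    by have := xsP; rewrite -(cvg_shiftS (fun k => norm2 (x k - xs))).
  apply: (@squeeze_cvgr _ \oo _ _ (fun _ => 0) (fun k => q * norm2 (x k - xs))).
  - by apply: nearW => k; rewrite norm2_ge0 /=; exact: fq.
  - exact: cvg_cst.
  - by rewrite -(mulr0 q); apply: cvgM (cvg_cst _) xsP.
exists xs => // y fy; apply/eqP; rewrite -subr_eq0; apply/eqP/norm2_eq0/le_anti.
rewrite norm2_ge0 andbT; have := fq y xs; rewrite fy fxs.
have := norm2_ge0 (y - xs); nra.
Qed.

End Completeness.

(** * Picard-CSCS iteration *)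

Section CSCS.
Variables (R : realType) (n : nat).
Implicit Types (x z b : 'cV[R[i]]_n) (A C S M : 'M[R[i]]_n).

Lemma ave_solutionE A b x :
  A \in unitmx -> ave_solution A b x <-> invmx A *m (cabs x + b) = x.
Proof.
move=> Au; split=> [<-|xE].
  by rewrite addrC subrK mulKmx.
by rewrite /ave_solution -{1}xE mulKVmx // addrC addKr.
Qed.

(** The equation is the fixed-point problem x = A^-1 (|x| + b), whose right-hand
    side is Lipschitz of constant the norm of A^-1. *)
Lemma ave_unique_solution A b : A \in unitmx -> opnorm2 (invmx A) < 1 ->
  exists2 xs, ave_solution A b xs & forall y, ave_solution A b y -> y = xs.
Proof.
move=> Au A1.
have [|xs xsE xs_unique] := @norm2_contraction_fixpoint _ _
    (fun x => invmx A *m (cabs x + b)) _ (opnorm2_ge0 _) A1.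
  move=> x y; rewrite -mulmxBr opprD addrACA subrr addr0.
  apply: le_trans (norm2_mulmx _ _) _.
  by rewrite ler_wpM2l ?opnorm2_ge0 ?norm2_cabsB.
exists xs; first exact/ave_solutionE.
by move=> y /(ave_solutionE _ _ Au); exact: xs_unique.
Qed.

(** The strict bounds on the individual powers leave a uniform margin.  With
    p = max(N, 1), the power M^p has norm below t <= 1, so by submultiplicativity the
    powers from 2p on are dominated by earlier ones, and the finite maximum over
    p <= s < 2p bounds them all.  The exponent 0 is avoided because for p = 0 that
    range would be empty. *)
Lemma opnorm2_powers_uniform M (N : nat) (t : R) : t <= 1 ->
  (forall s, (N <= s)%N -> opnorm2 (M ^+ s) < t) ->
  exists r, [/\ 0 <= r, r < t & forall s, (maxn N 1 <= s)%N -> opnorm2 (M ^+ s) <= r].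
Proof.
move=> t1 Mt; set p := maxn N 1; have p0 : (0 < p)%N by rewrite leq_max orbT.
have Np : (N <= p)%N by rewrite leq_max leqnn.
have t0 : 0 < t by apply: le_lt_trans (opnorm2_ge0 _) (Mt N (leqnn N)).
pose r := \big[Num.max/0]_(i < p) opnorm2 (M ^+ (p + i)).
have r0 : 0 <= r by apply: bigmax_ge_id.
exists r; split=> //.
  by apply: bigmax_lt => // i _; apply: Mt; exact: leq_trans Np (leq_addr _ _).
elim/ltn_ind => s IH ps; have [s2p|s2p] := ltnP s (p + p).
  have ip : (s - p < p)%N by lia.
  have -> : s = (p + Ordinal ip)%N by rewrite /= subnKC.
  exact: le_bigmax.
have -> : s = (p + (s - p))%N by rewrite subnKC.
rewrite exprD; apply: le_trans (opnorm2M _ _) _.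
apply: (@le_trans _ _ (opnorm2 (M ^+ (s - p)))); last by apply: IH; lia.
by rewrite ler_piMl ?opnorm2_ge0 // ltW // (lt_le_trans (Mt _ Np)).
Qed.

(** A solution of the linear system (C + S) z = f is a fixed point of both
    half-steps, because C + S = (s + C) - (s - S) = (s + S) - (s - C).  Hence a full inner sweep
    multiplies the error by the iteration matrix. *)
Lemma cscs_inner_error C S (sigma : R) (m : nat) (y h : nat -> 'cV[R[i]]_n) f z :
  (sigma%:C)%C%:M + C \in unitmx -> (sigma%:C)%C%:M + S \in unitmx ->
  (C + S) *m z = f ->
  (forall l : nat, (l < m)%N ->
     ((sigma%:C)%C%:M + C) *m h l = ((sigma%:C)%C%:M - S) *m y l + f /\
     ((sigma%:C)%C%:M + S) *m y l.+1 = ((sigma%:C)%C%:M - C) *m h l + f) ->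
  y m - z = iter_mx C S sigma ^+ m *m (y 0%N - z).
Proof.
set s := (sigma%:C)%C%:M => Cu Su <-; elim: m => [_|m IH hy].
  by rewrite expr0 mul1mx.
have [hE yE] := hy m (ltnSn m).
have hz : (s + C) *m (h m - z) = (s - S) *m (y m - z).
  rewrite !mulmxBr hE -addrA -mulmxBl; congr (_ + _).
  by rewrite [C + S]addrC [s + C]addrC addrKA -mulNmx opprB.
have yz : (s + S) *m (y m.+1 - z) = (s - C) *m (h m - z).
  rewrite !mulmxBr yE -addrA -mulmxBl; congr (_ + _).
  by rewrite [s + S]addrC addrKA -mulNmx opprB.
rewrite -(mulKmx Su (_ - z)) yz -(mulKmx Cu (h m - z)) hz.
rewrite exprS -[_ * _]/(_ *m _) -(mulmxA _ _ (y 0%N - z)) -IH => [|l lm]; last first.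
  by apply: hy; exact: ltnW.
by rewrite /iter_mx !mulmxA.
Qed.

(** The inner sweeps approximate the exact Picard iterate
    z = A^-1 (|x| + b), for which |z - xs| <= eta |x - xs|.  They leave the error
    |x' - z| <= theta |x - z| <= theta (1 + eta) |x - xs|, and the triangle
    inequality through z gives the factor. *)
Lemma cscs_outer_contraction C S (sigma : R) b xs x x' (m : nat) :
  (sigma%:C)%C%:M + C \in unitmx -> (sigma%:C)%C%:M + S \in unitmx ->
  C + S \in unitmx -> ave_solution (C + S) b xs ->
  picard_cscs_step C S sigma b m x x' ->
  let theta := opnorm2 (iter_mx C S sigma ^+ m) in
  let eta := opnorm2 (invmx (C + S)) in
  norm2 (x' - xs) <= (theta * (1 + eta) + eta) * norm2 (x - xs).
Proof.
move=> Cu Su Au /(ave_solutionE _ _ Au) xsE [y [h [y0 hy ->]]] /=.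
set theta := opnorm2 _; set eta := opnorm2 (invmx _).
pose z := invmx (C + S) *m (cabs x + b).
have zx : norm2 (z - xs) <= eta * norm2 (x - xs).
  rewrite -[X in z - X]xsE -mulmxBr opprD addrACA subrr addr0.
  apply: le_trans (norm2_mulmx _ _) _.
  by rewrite ler_wpM2l ?opnorm2_ge0 ?norm2_cabsB.
have yz : norm2 (y m - z) <= theta * norm2 (x - z).
  rewrite (@cscs_inner_error C S sigma m y h (cabs x + b)) ?mulKVmx // ?y0.
    exact: norm2_mulmx.
  by move=> l /hy; rewrite -!addrA.
have xz : norm2 (x - z) <= norm2 (x - xs) + norm2 (z - xs).
  have -> : x - z = (x - xs) - (z - xs) by rewrite opprB addrA subrK.
  exact: norm2B.
have -> : y m - xs = (y m - z) + (z - xs) by rewrite addrA subrK.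
apply: le_trans (norm2D _ _) _.
have := opnorm2_ge0 (iter_mx C S sigma ^+ m); rewrite -/theta; nra.
Qed.

Lemma picard_cscs_exists C S (sigma : R) b x0 (l : nat -> nat) :
  (sigma%:C)%C%:M + C \in unitmx -> (sigma%:C)%C%:M + S \in unitmx ->
  exists x : nat -> 'cV[R[i]]_n, picard_cscs C S sigma b x0 l x.
Proof.
set s := (sigma%:C)%C%:M => Cu Su.
pose half x y := invmx (s + C) *m ((s - S) *m y + cabs x + b).
pose full x y := invmx (s + S) *m ((s - C) *m half x y + cabs x + b).
pose fix u (k : nat) : 'cV[R[i]]_n :=
  if k is k'.+1 then iter (l k') (full (u k')) (u k') else x0.
exists u; split=> // k.
exists (fun j => iter j (full (u k)) (u k)).
exists (fun j => half (u k) (iter j (full (u k)) (u k))).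
by split=> // j _; split; rewrite /= mulKVmx.
Qed.

(** The contraction factor theta (1 + eta) + eta is below 1 exactly when
    theta < (1 - eta) / (1 + eta), and the uniform bound on the powers keeps it
    away from 1 along the iteration. *)
Lemma picard_cscs_cvg C S (sigma : R) b xs x0 (l : nat -> nat) (N : nat)
    (x : nat -> 'cV[R[i]]_n) :
  let eta := opnorm2 (invmx (C + S)) in
  (sigma%:C)%C%:M + C \in unitmx -> (sigma%:C)%C%:M + S \in unitmx ->
  C + S \in unitmx -> eta < 1 -> ave_solution (C + S) b xs ->
  (forall k, (0 < l k)%N) ->
  (forall s, (N <= s)%N ->
     opnorm2 (iter_mx C S sigma ^+ s) < (1 - eta) / (1 + eta)) ->
  ((N%:R : R)%:E <= limn_einf (fun k : nat => ((l k)%:R : R)%:E))%E ->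
  picard_cscs C S sigma b x0 l x ->
  norm2 (x k - xs) @[k --> \oo] --> (0 : R).
Proof.
move=> eta Cu Su Au eta1 xsP l0 MN /limn_einf_nat_ge[K lK] [_ xP].
have eta0 : 0 <= eta by exact: opnorm2_ge0.
have t1 : (1 - eta) / (1 + eta) <= 1 by rewrite ler_pdivrMr; lra.
have [r [r0 rt rM]] := opnorm2_powers_uniform t1 MN.
apply: (@eventually_contracting_cvg0 _ _ (r * (1 + eta) + eta) K).
- by move=> k; exact: norm2_ge0.
- by nra.
- by move: rt; rewrite ltr_pdivlMr; lra.
move=> k Kk; apply: le_trans (cscs_outer_contraction Cu Su Au xsP (xP k)) _.
rewrite ler_wpM2r ?norm2_ge0 // lerD2r ler_wpM2r ?addr_ge0 //.
by apply: rM; rewrite geq_max lK // l0.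
Qed.

End CSCS.

Theorem theorem3p1 (R : realType) (n : nat) (a : int -> R[i])
    (A C S : 'M[R[i]]_n) (sigma eta : R) (b : 'cV[R[i]]_n)
    (A_toeplitz : A = toeplitz n a)
    (C_circ : C = circ_part n a) (S_skew : S = skew_circ_part n a)
    (A_nonherm : A \isn't hermsymmx)
    (C_posdef : posdef C) (S_posdef : posdef S)
    (sigma_gt0 : 0 < sigma)
    (eta_def : eta = opnorm2 (invmx A)) (eta_lt1 : eta < 1) :
  exists xs : 'cV[R[i]]_n,
    [/\ ave_solution A b xs,
        forall y : 'cV[R[i]]_n, ave_solution A b y -> y = xs
      & forall (x0 : 'cV[R[i]]_n) (l : nat -> nat) (N : nat),
          (forall k : nat, (0 < l k)%N) ->
          (forall s : nat, (N <= s)%N ->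
             opnorm2 (iter_mx C S sigma ^+ s) < (1 - eta) / (1 + eta)) ->
          ((N%:R : R)%:E <= limn_einf (fun k : nat => ((l k)%:R : R)%:E))%E ->
          (exists x : nat -> 'cV[R[i]]_n, picard_cscs C S sigma b x0 l x) /\
          (forall x : nat -> 'cV[R[i]]_n, picard_cscs C S sigma b x0 l x ->
             norm2 (x k - xs) @[k --> \oo] --> (0 : R))].
Proof.
subst A C S eta; move: A_nonherm eta_lt1 => _; rewrite toeplitz_splitting => eta1.
set C := circ_part n a in C_posdef eta1 *.
set S := skew_circ_part n a in S_posdef eta1 *.
have Cu : (sigma%:C)%C%:M + C \in unitmx by exact: posdef_shift_unit.
have Su : (sigma%:C)%C%:M + S \in unitmx by exact: posdef_shift_unit.
have Au : C + S \in unitmx.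
  apply: posdef_normalD_unit => //; first exact: circ_part_normal.
  exact: skew_circ_part_normal.
have [xs xsP xs_unique] := ave_unique_solution b Au eta1.
exists xs; split=> // x0 l N l0 MN lN; split; first exact: picard_cscs_exists.
by move=> x; apply: (picard_cscs_cvg Cu Su Au eta1 xsP l0 MN lN).
Qed.
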